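(* Let $x,y,u,v$ be indeterminates and let the polynomials $M_n(x,y,u,v)$ ($n\ge0$) be defined by the S-type continued fraction $$\sum_{n=0}^\infty M_n(x,y,u,v)\,t^n=\cfrac{1}{1-\cfrac{\alpha_1t}{1-\cfrac{\alpha_2t}{1-\cfrac{\alpha_3t}{1-\cdots}}}}$$ with coefficients $\alpha_{2k-1}=x+(2k-2)u$ and $\alpha_{2k}=y+(2k-1)v$ for $k\ge1$. Then for all $n\ge0$ $$M_n(x,y,u,v)=\sum_{\sigma\in\mathcal I_{2n}}x^{\mathrm{ecpar}(\sigma)}y^{\mathrm{ocpar}(\sigma)}u^{\mathrm{ecpnar}(\sigma)}v^{\mathrm{ocpnar}(\sigma)}=\sum_{\sigma\in\mathcal I_{2n}}x^{\mathrm{ocvr}(\sigma)}y^{\mathrm{ecvr}(\sigma)}u^{\mathrm{ocvnr}(\sigma)}v^{\mathrm{ecvnr}(\sigma)},$$ where the sums run over the set $\mathcal I_{2n}$ of fixed-point-free involutions of $[2n]$.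
   Context: $[2n]=\{1,\dots,2n\}$. Continued fractions are identities of formal power series in $t$. For a permutation $\sigma$ of $[2n]$, an index $i$ is a record if $\sigma(j)<\sigma(i)$ for all $j<i$, and an antirecord if $\sigma(j)>\sigma(i)$ for all $j>i$; it is a cycle peak if $\sigma^{-1}(i)<i>\sigma(i)$ and a cycle valley if $\sigma^{-1}(i)>i<\sigma(i)$. (For a fixed-point-free involution the cycle peaks/valleys are the largest/smallest elements of the 2-cycles.) $\mathrm{ecpar}$, $\mathrm{ocpar}$, $\mathrm{ecpnar}$, $\mathrm{ocpnar}$ are the numbers of cycle peaks $i$ that are, respectively: even and an antirecord; odd and an antirecord; even and not an antirecord; odd and not an antirecord. $\mathrm{ecvr}$, $\mathrm{ocvr}$, $\mathrm{ecvnr}$, $\mathrm{ocvnr}$ are the numbers of cycle valleys $i$ that are, respectively: even and a record; odd and a record; even and not a record; odd and not a record. *)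

(* Defs.v *)
From HB Require Import structures.
From mathcomp Require Import all_boot all_order all_algebra all_fingroup.
From mathcomp Require Import mpoly.
Set Implicit Arguments.
Unset Strict Implicit.
Unset Printing Implicit Defensive.
Import GRing.Theory.
Local Open Scope ring_scope.

(* A formal power series in t is represented by its coefficient sequence. *)
Definition fps (R : comNzRingType) := nat -> R.

Section FormalPowerSeries.
Variable R : comNzRingType.
Implicit Types (f g h : fps R) (alpha : nat -> R).

Definition fps_one : fps R := fun n => (n == 0)%:R.

Definition fps_sub f g : fps R := fun n => f n - g n.

Definition fps_mul f g : fps R := fun n => \sum_(i < n.+1) f i * g (n - i)%N.

Definition fps_exp h (k : nat) : fps R := iter k (fps_mul h) fps_one.

(* The series a * t * f. *)
Definition fps_scalet (a : R) f : fps R :=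
  fun n => if n is m.+1 then a * f m else 0.

(* The inverse 1 / (1 - h) = \sum_k h ^ k of a series with h 0 = 0: the powers
   h ^ k with k > n do not contribute to the coefficient of t ^ n, see
   [fps_inv1BP]. *)
Definition fps_inv1B h : fps R := fun n => \sum_(k < n.+1) fps_exp h k n.

(* The finite continued fraction
   1 / (1 - alpha_k t / (1 - alpha_(k+1) t / ( ... / (1 - alpha_(k+N-1) t)))),
   equal to 1 when N = 0. *)
Fixpoint Sconvergent alpha (k N : nat) : fps R :=
  if N is N'.+1
  then fps_inv1B (fps_scalet (alpha k) (Sconvergent alpha k.+1 N'))
  else fps_one.

(* f is the infinite S-fraction with coefficients alpha_1, alpha_2, ... (alpha_0
   is not used): its convergents tend to f in the t-adic topology. *)
Definition is_Sfraction alpha f : Prop :=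
  forall n, exists N0, forall N, (N0 <= N)%N -> Sconvergent alpha 1 N n = f n.

Lemma fps_exp_small h : h 0%N = 0 ->
  forall k n, (n < k)%N -> fps_exp h k n = 0.
Proof.
move=> h0; elim=> [//|k IHk] n ltnk; rewrite /fps_exp iterS -/(fps_exp h k).
rewrite /fps_mul big1 // => -[[|i] lti] _ /=; first by rewrite h0 mul0r.
rewrite IHk ?mulr0 //; rewrite !ltnS in lti ltnk.
by case: n lti ltnk => [//|n] _ ltnk; rewrite subSS (leq_ltn_trans (leq_subr _ _)).
Qed.

Lemma fps_inv1BP h : h 0%N = 0 ->
  fps_mul (fps_sub fps_one h) (fps_inv1B h) =1 fps_one.
Proof.
move=> h0 n.
have trunc i : (i <= n)%N -> fps_inv1B h i = \sum_(k < n.+1) fps_exp h k i.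
  move=> lein; rewrite /fps_inv1B -!(big_mkord xpredT (fun k => fps_exp h k i)).
  rewrite [RHS](big_cat_nat (n := i.+1)) //=.
  rewrite [X in _ + X]big_nat [X in _ + X]big1 ?addr0 //.
  by move=> k /andP[ltik _]; rewrite fps_exp_small.
have hG : \sum_(i < n.+1) h i * fps_inv1B h (n - i)%N
          = \sum_(k < n.+1) fps_exp h k.+1 n.
  under eq_bigr => i _ do rewrite trunc ?leq_subr // mulr_sumr.
  by rewrite exchange_big.
have oneG : \sum_(i < n.+1) fps_one i * fps_inv1B h (n - i)%N = fps_inv1B h n.
  rewrite big_ord_recl /= subn0 mul1r big1 ?addr0 // => i _.
  by rewrite /fps_one /= mul0r.
rewrite /fps_mul /fps_sub.
under eq_bigr => i _ do rewrite mulrBl.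
rewrite sumrB oneG hG /fps_inv1B big_ord_recl [X in _ - X]big_ord_recr.
have /= -> : fps_exp h (@ord_max n).+1 n = 0 by rewrite fps_exp_small.
by rewrite /= addr0; apply: addrK.
Qed.

Lemma eq_fps_inv1B h g n : (forall i, (i <= n)%N -> h i = g i) ->
  fps_inv1B h n = fps_inv1B g n.
Proof.
move=> ehg; apply: eq_bigr => k _.
have E j m : (m <= n)%N -> fps_exp h j m = fps_exp g j m; last exact: E.
elim: j m => [//|j IHj] m lemn; apply: eq_bigr => i _.
rewrite ehg; last by rewrite (leq_trans _ lemn) // -ltnS.
by congr (_ * _); apply: IHj; rewrite (leq_trans (leq_subr _ _)).
Qed.

Lemma Sconvergent_stable alpha k N n : (n <= N)%N ->
  Sconvergent alpha k N.+1 n = Sconvergent alpha k N n.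
Proof.
elim: N k n => [|N IHN] k n lenN.
  move: lenN; rewrite leqn0 => /eqP->.
  by rewrite /= /fps_inv1B big_ord1.
apply: eq_fps_inv1B => -[//|i] lein; congr (_ * _); apply: IHN.
by rewrite -ltnS (leq_trans lein).
Qed.

Lemma Sfraction_exists alpha :
  is_Sfraction alpha (fun n => Sconvergent alpha 1 n n).
Proof.
move=> n; exists n => N leN; rewrite -(subnKC leN).
elim: (N - n)%N => [|d IHd]; first by rewrite addn0.
by rewrite addnS Sconvergent_stable ?leq_addr.
Qed.

Lemma Sfraction_unique alpha f g :
  is_Sfraction alpha f -> is_Sfraction alpha g -> f =1 g.
Proof.
move=> Hf Hg n; have [[Nf Ef] [Ng Eg]] := (Hf n, Hg n).
by rewrite -(Ef (maxn Nf Ng)) ?leq_maxl // Eg ?leq_maxr.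
Qed.

End FormalPowerSeries.

(* The element i of 'I_m stands for the element i.+1 of {1, ..., m}; this shift
   does not affect comparisons, but it does affect parities. *)
Section Statistics.
Variable m : nat.
Implicit Types (s : 'S_m) (i : 'I_m).

Definition even_index i : bool := ~~ odd i.+1.
Definition odd_index i : bool := odd i.+1.

Definition is_record s i : bool := [forall j : 'I_m, (j < i)%N ==> (s j < s i)%N].
Definition is_antirecord s i : bool :=
  [forall j : 'I_m, (i < j)%N ==> (s i < s j)%N].

Definition cycle_peak s i : bool := ((s^-1)%g i < i)%N && (s i < i)%N.
Definition cycle_valley s i : bool := (i < (s^-1)%g i)%N && (i < s i)%N.

Definition ecpar s : nat :=
  #|[set i | [&& cycle_peak s i, even_index i & is_antirecord s i]]|.
Definition ocpar s : nat :=
  #|[set i | [&& cycle_peak s i, odd_index i & is_antirecord s i]]|.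
Definition ecpnar s : nat :=
  #|[set i | [&& cycle_peak s i, even_index i & ~~ is_antirecord s i]]|.
Definition ocpnar s : nat :=
  #|[set i | [&& cycle_peak s i, odd_index i & ~~ is_antirecord s i]]|.

Definition ecvr s : nat :=
  #|[set i | [&& cycle_valley s i, even_index i & is_record s i]]|.
Definition ocvr s : nat :=
  #|[set i | [&& cycle_valley s i, odd_index i & is_record s i]]|.
Definition ecvnr s : nat :=
  #|[set i | [&& cycle_valley s i, even_index i & ~~ is_record s i]]|.
Definition ocvnr s : nat :=
  #|[set i | [&& cycle_valley s i, odd_index i & ~~ is_record s i]]|.

Definition fpf_involutions : {set 'S_m} :=
  [set s : 'S_m | [forall i, (s (s i) == i) && (s i != i)]].

End Statistics.

Definition X : {mpoly int[4]} := 'X_(@Ordinal 4 0 isT).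
Definition Y : {mpoly int[4]} := 'X_(@Ordinal 4 1 isT).
Definition U : {mpoly int[4]} := 'X_(@Ordinal 4 2 isT).
Definition V : {mpoly int[4]} := 'X_(@Ordinal 4 3 isT).

(* Main.v *)
Require Import Defs.
From HB Require Import structures.
From mathcomp Require Import all_boot all_order all_algebra all_fingroup.
From mathcomp Require Import mpoly.
Set Implicit Arguments.
Unset Strict Implicit.
Unset Printing Implicit Defensive.
Import GRing.Theory.
Local Open Scope ring_scope.

(** The coefficient of t^n in the S-fraction is the weighted number of Dyck
    paths of length 2n in which a down step from height h+1 to height h weighs
    alpha_(h+1) (Flajolet).  Here this follows from one recurrence: the
    coefficients F_k of the fraction started at alpha_k satisfy
    F_k = 1 + alpha_k t F_(k+1) F_k, and cutting a Dyck path at its last visit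
    to the axis gives the same equation for path sums
    ([path_sum_last_visit], [Sfraction_path_sum]).

    Perfect matchings (fixed-point-free involutions) are read from left to
    right.  What has been seen after m positions is an involution of the first
    m positions whose h fixed points are the arcs still waiting for their
    closer.  The next position either opens an arc, so that h increases, or
    closes one of the waiting arcs, so that h decreases.  A closer i is an
    antirecord exactly when it picks the smallest waiting opener, because every
    smaller waiting opener j will be closed at some later j' > i with
    s j' = j < s i.  So a down step from height h+1 offers one choice
    that yields an antirecord and h choices that do not
    ([sum_matching_weight_rec]).  The number of waiting arcs has the parity of
    m, so the parity of the closer is determined by h: the closer i (counted
    from 1) is even when h+1 is odd, giving x + h u, and odd when h+1 is even,
    giving y + h v.  These are the coefficients alpha_(h+1), which proves the
    first formula.

    The second formula is the first one read backwards: conjugation by the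
    reversal i -> 2n+1-i exchanges peaks with valleys, antirecords with records
    and even with odd positions ([reverse_stats]). *)

(** * S-fractions and Dyck paths *)

Section Paths.
Variables (R : comNzRingType) (a : nat -> R).

(** The weighted number of nonnegative lattice paths with [m] unit steps from
    height 0 to height [h], a down step ending at height [j] having weight
    [a (k + j)].  The recursion removes the last step; the offset [k] is there
    because raising a path by one unit turns it into [k.+1]. *)
Fixpoint path_sum (k m h : nat) : R :=
  if m is m'.+1
  then (if h is h'.+1 then path_sum k m' h' else 0)
       + a (k + h)%N * path_sum k m' h.+1
  else (h == 0%N)%:R.

Lemma path_sum_parity k m h : odd m != odd h -> path_sum k m h = 0.
Proof.
elim: m h => [|m IHm] [|h] //= neq_odd.
  by rewrite (IHm 1%N) ?mulr0 ?addr0 //; case: (odd m) neq_odd.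
rewrite IHm; last by case: (odd m) (odd h) neq_odd => [] [].
by rewrite IHm ?mulr0 ?addr0 //=; case: (odd m) (odd h) neq_odd => [] [].
Qed.

(** After its last visit to height 0, at time i, a path takes an up step and
    then stays at height at least 1: lowered by one, the rest is a path of
    offset [k.+1]. *)
Lemma path_sum_last_visit k m h :
  path_sum k m.+1 h.+1 =
  \sum_(i < m.+1) path_sum k i 0 * path_sum k.+1 (m - i) h.
Proof.
elim: m h => [|m IHm] h.
  by rewrite big_ord1 /= mulr0 addr0 mul1r.
have Eterm (i : 'I_m.+1) : path_sum k i 0 * path_sum k.+1 (m.+1 - i) h =
    path_sum k i 0 * (if h is h'.+1 then path_sum k.+1 (m - i) h' else 0)
    + a (k + h.+1)%N * (path_sum k i 0 * path_sum k.+1 (m - i) h.+1).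
  by rewrite subSn -1?ltnS //= mulrDr mulrCA addSnnS.
rewrite big_ord_recr (eq_bigr _ (fun i _ => Eterm i)) big_split /= -mulr_sumr.
rewrite subnn -IHm [LHS]/= addrAC; congr (_ + _).
case: h {Eterm} => [|h]; last by rewrite /= mulr0 addr0 -IHm.
by rewrite /= mulr1 big1 ?add0r // => i _; rewrite mulr0.
Qed.

Lemma sum_ord_even (f : nat -> R) n : (forall i, odd i -> f i = 0) ->
  \sum_(i < n.*2.+1) f i = \sum_(i < n.+1) f i.*2.
Proof.
move=> f_odd; elim: n => [|n IHn]; first by rewrite !big_ord1.
rewrite doubleS big_ord_recr big_ord_recr /= IHn f_odd /= ?odd_double //.
by rewrite addr0 [RHS]big_ord_recr.
Qed.

(** The last step of a nonempty Dyck path descends from height 1; what precedes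
    it is cut at its last visit to the axis, which occurs at an even time. *)
Lemma path_sum_convolution k n :
  path_sum k n.+1.*2 0 =
  a k * \sum_(i < n.+1) path_sum k.+1 i.*2 0 * path_sum k (n - i).*2 0.
Proof.
rewrite doubleS [LHS]/= add0r addn0 -[LHS]/(a k * path_sum k n.*2.+1 1).
rewrite path_sum_last_visit.
rewrite (sum_ord_even
  (f := fun i => path_sum k i 0 * path_sum k.+1 (n.*2 - i) 0)).
  congr (_ * _); rewrite [RHS](reindex_inj rev_ord_inj) /=.
  apply: eq_bigr => i _.
  by rewrite subSS subKn -1?ltnS // doubleB mulrC.
by move=> i odd_i; rewrite path_sum_parity ?mul0r /= ?odd_i.
Qed.

(** The equation F = 1 + a_k t G F for F = 1 / (1 - a_k t G), read off at a
    positive power of t. *)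
Lemma Sconvergent_rec k N n :
  Sconvergent a k N.+1 n.+1 =
  a k * \sum_(i < n.+1) Sconvergent a k.+1 N i * Sconvergent a k N.+1 (n - i)%N.
Proof.
rewrite [Sconvergent a k N.+1]/=; set h := fps_scalet _ _.
have := fps_inv1BP (erefl : h 0%N = 0) n.+1.
rewrite /fps_mul /fps_sub /fps_one big_ord_recl /= subr0 mul1r subn0.
move/eqP; rewrite addr_eq0 => /eqP->; rewrite -sumrN mulr_sumr.
by apply: eq_bigr => i _; rewrite sub0r mulNr opprK subSS mulrA.
Qed.

Lemma Sconvergent_path_sum k N n : (n <= N)%N ->
  Sconvergent a k N n = path_sum k n.*2 0.
Proof.
elim: N k n => [|N IHN] k n; first by rewrite leqn0 => /eqP->.
elim/ltn_ind: n => -[|n] IHn lenN.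
  by rewrite /= /fps_inv1B big_ord1.
rewrite Sconvergent_rec path_sum_convolution; congr (_ * _).
apply: eq_bigr => i _; have lein : (i <= n)%N by rewrite -ltnS.
rewrite IHN ?(leq_trans lein) // IHn ?ltnS ?leq_subr //.
by rewrite (leq_trans (leq_subr _ _)) // ltnW.
Qed.

Lemma Sfraction_path_sum f n : is_Sfraction a f -> f n = path_sum 1 n.*2 0.
Proof.
case/(_ n) => N0 /(_ (maxn N0 n)) <-; last exact: leq_maxl.
by rewrite Sconvergent_path_sum ?leq_maxr.
Qed.

End Paths.

(** * Growing an involution one position at a time *)

Section Involutions.
Variables (R : comNzRingType) (N : nat) (c : 'I_N -> bool -> R).
Implicit Types (s t : 'S_N) (i j p : 'I_N).

Definition fixed_below (m : nat) s : {set 'I_N} :=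
  [set i : 'I_N | (i < m)%N && (s i == i)].

(** A matching of the first [m] positions with [h] arcs still open is encoded as
    an involution: a fixed point below [m] is an opener without a closer yet.
    Keeping all stages inside the same symmetric group (identity from [m] on)
    makes closing an arc a multiplication by a transposition. *)
Definition partial_matchings (m h : nat) : {set 'S_N} :=
  [set s : 'S_N | [&& [forall i, s (s i) == i],
     [forall i : 'I_N, (m <= i)%N ==> (s i == i)] & #|fixed_below m s| == h]].

(** At the moment when [i] closes the arc from [s i], no smaller opener is
    waiting.  A smaller [j] is waiting if it is closed after [i], or not closed
    yet, hence the two conditions; with both of them the truth value for [i]
    never changes when further positions are added. *)
Definition closes_first s i : bool :=
  [forall j : 'I_N, (j < s i)%N ==> (s j != j) && (s j < i)%N].

Definition matching_weight s : R :=
  \prod_(i < N | (s i < i)%N) c i (closes_first s i).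

Lemma partial_matchingsP m h s :
  reflect [/\ involutive s, forall i, (m <= i)%N -> s i = i
            & #|fixed_below m s| = h]
          (s \in partial_matchings m h).
Proof.
rewrite inE; apply: (iffP and3P) => -[sK s_id s_h].
  split; last exact/eqP.
    by move=> i; apply/eqP/(forallP sK).
  by move=> i lemi; apply/eqP/(implyP (forallP s_id i)).
split; last exact/eqP.
  by apply/forallP => i; rewrite sK.
by apply/forallP => i; apply/implyP => /s_id->.
Qed.

Lemma sum_matching_weight0 h :
  \sum_(s in partial_matchings 0 h) matching_weight s = (h == 0%N)%:R.
Proof.
have fixed0 s : fixed_below 0 s = set0 by apply/setP => i; rewrite !inE.
have [->|h_neq0] := eqVneq h 0%N; last first.
  rewrite big1 // => s /partial_matchingsP[_ _].
  by rewrite fixed0 cards0 => h0; rewrite -h0 eqxx in h_neq0.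
rewrite (big_pred1 1%g) => [|s].
  by rewrite /matching_weight big_pred0 // => i; rewrite perm1 ltnn.
apply/partial_matchingsP/eqP => [[_ s_id _]|->].
  by apply/permP => i; rewrite perm1 s_id.
by rewrite fixed0 cards0; split=> // i; rewrite !perm1.
Qed.

Lemma fixed_belowS (m : 'I_N) s :
  fixed_below m.+1 s =
  if s m == m then m |: fixed_below m s else fixed_below m s.
Proof.
apply/setP => i; case: ifPn => sm; rewrite !inE ltnS leq_eqVlt.
  have [->|neq_im] := eqVneq i m; first by rewrite eqxx sm.
  by rewrite (negPf neq_im : (i == m :> nat) = false).
have [->|neq_im] := eqVneq i m; first by rewrite (negPf sm) !andbF.
by rewrite (negPf neq_im : (i == m :> nat) = false).
Qed.

(** When [m] is a fixed point it is a new opener, and the involution is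
    literally one of the previous stage. *)
Lemma partial_matchings_open (m : 'I_N) h s :
  (s \in partial_matchings m.+1 h) && (s m == m) =
  if h is h'.+1 then s \in partial_matchings m h' else false.
Proof.
have cardE : s m = m -> #|fixed_below m.+1 s| = #|fixed_below m s|.+1.
  by move=> sm; rewrite fixed_belowS sm eqxx cardsU1 !inE ltnn.
apply/andP/idP => [[/partial_matchingsP[sK s_id s_h] /eqP sm]|].
  case: h s_h => [|h]; rewrite cardE // => -[s_h].
  apply/partial_matchingsP; split=> // i; rewrite leq_eqVlt => /orP[|/s_id //].
  by move/eqP/val_inj <-.
case: h => // h /partial_matchingsP[sK s_id s_h].
have sm : s m = m by rewrite s_id.
split; last by rewrite sm.
apply/partial_matchingsP; split=> // [i /ltnW/s_id //|].
by rewrite cardE // s_h.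
Qed.

(** Multiplying by the transposition of [p] and [m] creates the arc between the
    two fixed points [p] and [m]. *)
Section Arc.
Variables (m p : 'I_N) (t : 'S_N).
Hypotheses (tm : t m = m) (tp : t p = p).
Let s := (t * tperm p m)%g.

Lemma arc_m : s m = p. Proof. by rewrite permM tm tpermR. Qed.
Lemma arc_p : s p = m. Proof. by rewrite permM tp tpermL. Qed.
Lemma arc_other i : i != p -> i != m -> s i = t i.
Proof.
move=> ip im; rewrite permM tpermD //.
  by apply: contraNneq ip => E; rewrite -(inj_eq (@perm_inj _ t)) -E tp.
by apply: contraNneq im => E; rewrite -(inj_eq (@perm_inj _ t)) -E tm.
Qed.

End Arc.

(** Multiplication by a transposition is invertible, so for each [p] the
    matchings in which [m] closes the arc from [p] correspond to those of the
    previous stage in which [p] is waiting. *)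
Lemma partial_matchings_close (m p : 'I_N) h t : (p < m)%N ->
  ((t * tperm p m)%g \in partial_matchings m.+1 h)
    && ((t * tperm p m)%g m == p) =
  (t \in partial_matchings m h.+1) && (t p == p).
Proof.
move=> ltpm; set s := (t * tperm p m)%g.
have neqpm : p != m by rewrite -val_eqE /= neq_ltn ltpm.
have fixE : t m = m -> t p = p ->
    fixed_below m t = p |: fixed_below m.+1 s.
  move=> tm tp; rewrite fixed_belowS arc_m // (negPf neqpm).
  apply/setP => i; rewrite !inE.
  have [->|ip] := eqVneq i p; first by rewrite ltpm tp eqxx.
  have [->|im] := eqVneq i m; first by rewrite ltnn.
  by rewrite arc_other.
have cardE : t m = m -> t p = p ->
    #|fixed_below m t| = #|fixed_below m.+1 s|.+1.
  move=> tm tp; rewrite fixE // cardsU1 !inE arc_p //.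
  by rewrite [m == p]eq_sym (negPf neqpm) andbF.
apply/andP/andP => [[/partial_matchingsP[sK s_id s_h] /eqP sm]|
                    [/partial_matchingsP[tK t_id t_h] /eqP tp]].
  have sp : s p = m by rewrite -sm sK.
  have tE : t = (s * tperm p m)%g by rewrite -mulgA tperm2 mulg1.
  have tm : t m = m by rewrite tE permM sm tpermL.
  have tp : t p = p by rewrite tE permM sp tpermR.
  split; last by rewrite tp.
  apply/partial_matchingsP; split; last by rewrite cardE // s_h.
    move=> i; have [->|ip] := eqVneq i p; first by rewrite !tp.
    have [->|im] := eqVneq i m; first by rewrite !tm.
    rewrite -(@arc_other m p t tm tp i) //.
    rewrite -(@arc_other m p t tm tp (s i)) ?sK //.
      by apply: contraNneq im => si; rewrite -(sK i) si sp.
    by apply: contraNneq ip => si; rewrite -(sK i) si sm.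
  move=> i; rewrite leq_eqVlt => /orP[/eqP/val_inj <- //|ltmi].
  rewrite -(@arc_other m p t tm tp i) ?s_id //.
    by rewrite -val_eqE /= neq_ltn (ltn_trans ltpm ltmi) orbT.
  by rewrite -val_eqE /= neq_ltn ltmi orbT.
have tm : t m = m by rewrite t_id.
split; last by rewrite arc_m.
apply/partial_matchingsP; split; last first.
- by apply/eqP; rewrite -eqSS -cardE // t_h.
- move=> i ltmi; rewrite arc_other // ?t_id 1?ltnW // -val_eqE /= neq_ltn.
    by rewrite (ltn_trans ltpm ltmi) orbT.
  by rewrite ltmi orbT.
move=> i; have [->|ip] := eqVneq i p; first by rewrite arc_p // arc_m.
have [->|im] := eqVneq i m; first by rewrite arc_m // arc_p.
rewrite (arc_other tm tp ip im) arc_other ?tK //.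
  by apply: contraNneq ip => ti; rewrite -(tK i) ti tp.
by apply: contraNneq im => ti; rewrite -(tK i) ti tm.
Qed.

Lemma partial_matching_ltn (m : 'I_N) h t j :
  t \in partial_matchings m h -> (j < m)%N -> (t j < m)%N.
Proof.
case/partial_matchingsP => tK t_id _ ltjm; rewrite ltnNge.
apply/negP => lemt; have := t_id _ lemt; rewrite tK => tj.
by rewrite -tj leqNgt ltjm in lemt.
Qed.

(** The new arc multiplies the weight by the factor of its closer [m] alone: for
    an earlier closer the opener [p] counts as waiting both when it is fixed
    and when it is sent to [m]. *)
Lemma matching_weight_close (m p : 'I_N) h t :
  (p < m)%N -> t \in partial_matchings m h -> t p = p ->
  matching_weight (t * tperm p m)%g =
  matching_weight t
  * c m [forall j : 'I_N, (j < p)%N ==> (j \notin fixed_below m t)].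
Proof.
move=> ltpm t_pm tp; have /partial_matchingsP[_ t_id _] := t_pm.
have tm : t m = m by rewrite t_id.
have [[sm sp] so] := (arc_m p tm, arc_p m tp, arc_other tm tp).
set s := (t * tperm p m)%g in sm sp so *.
rewrite /matching_weight (bigD1 m) /=; last by rewrite sm.
rewrite mulrC; congr (_ * c m _); last first.
  apply: eq_forallb => j; rewrite sm inE; have [ltjp|] //= := ltnP j p.
  have ltjm := ltn_trans ltjp ltpm.
  have [jp jm] : j != p /\ j != m by rewrite -!val_eqE /= !neq_ltn ltjp ltjm.
  by rewrite so // ltjm (partial_matching_ltn t_pm) // andbT.
apply: eq_big => [i|i /andP[lt_si_i im]].
  have [->|im] := eqVneq i m; first by rewrite tm ltnn andbF.
  have [->|ip] := eqVneq i p; last by rewrite so // andbT.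
  by rewrite sp tp ltnn andbT ltnNge ltnW.
have ip : i != p by apply: contraTneq lt_si_i => ->; rewrite sp -leqNgt ltnW.
rewrite so // in lt_si_i.
have ltim : (i < m)%N.
  by rewrite ltnNge; apply: contraL lt_si_i => /t_id->; rewrite ltnn.
congr (c i _); apply: eq_forallb => j; rewrite so //.
have [ltj|] //= := ltnP j (t i).
have ltji := ltn_trans ltj lt_si_i.
have jm : j != m by rewrite -val_eqE /= neq_ltn (ltn_trans ltji).
have [->|jp] := eqVneq j p; last by rewrite so.
by rewrite tp eqxx sp [(m < i)%N]ltnNge ltnW // andbF.
Qed.

(** Among the elements of a nonempty set of ordinals exactly one is minimal. *)
Lemma sum_first (F : {set 'I_N}) h (f : bool -> R) : #|F| = h.+1 ->
  \sum_(p in F) f [forall j : 'I_N, (j < p)%N ==> (j \notin F)] =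
  f true + h%:R * f false.
Proof.
move=> cardF; have /card_gt0P[p1 Fp1] : (0 < #|F|)%N by rewrite cardF.
case: (arg_minnP val Fp1) => p0 p0F p0_min; have Fp0 : p0 \in F := p0F.
have p0_first : [forall j : 'I_N, (j < p0)%N ==> (j \notin F)].
  apply/forallP => j; apply/implyP; rewrite ltnNge.
  by apply: contra => /p0_min.
rewrite (bigD1 p0) //= p0_first; congr (_ + _).
rewrite (eq_bigr (fun=> f false)) => [|p /andP[Fp neq_p]].
  rewrite sumr_const mulr_natl; congr (_ *+ _).
  move: cardF; rewrite (cardD1 p0) Fp0 => -[<-].
  by apply: eq_card => p; rewrite !inE andbC.
congr f; apply/forallP => /(_ p0) /implyP; rewrite Fp0 => p_first.
have := p_first _; rewrite ltn_neqAle p0_min // val_eqE eq_sym neq_p.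
by move/(_ isT).
Qed.

(** Either [m] opens an arc, or it closes one of the [h.+1] waiting arcs, of
    which exactly one is the first. *)
Lemma sum_matching_weight_rec (m : 'I_N) h :
  \sum_(s in partial_matchings m.+1 h) matching_weight s =
  (if h is h'.+1
   then \sum_(s in partial_matchings m h') matching_weight s else 0)
  + (c m true + h%:R * c m false)
    * \sum_(s in partial_matchings m h.+1) matching_weight s.
Proof.
rewrite (partition_big (fun s => s m) predT) //= (bigD1 m) //=; congr (_ + _).
  rewrite (eq_bigl _ _ (partial_matchings_open m h)).
  by case: h => [|h]; first exact: big_pred0.
transitivity (\sum_(p < N | (p < m)%N)
    \sum_(t | (t \in partial_matchings m h.+1) && (t p == p))
      matching_weight t
      * c m [forall j : 'I_N, (j < p)%N ==> (j \notin fixed_below m t)]).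
  (* p > m is impossible, since s fixes all positions beyond m *)
  rewrite [RHS]big_mkcond [LHS]big_mkcond; apply: eq_bigr => p _ /=.
  case: (ltngtP p m) => [ltpm|ltmp|/val_inj->]; last by rewrite eqxx.
    rewrite -val_eqE /= neq_ltn ltpm /=.
    rewrite (reindex_inj (mulIg (tperm p m))) /=.
    rewrite (eq_bigl _ _ (fun t => partial_matchings_close h t ltpm)).
    apply: eq_bigr => t /andP[t_pm /eqP tp].
    exact: matching_weight_close t_pm tp.
  rewrite -val_eqE /= neq_ltn ltmp orbT big_pred0 // => s; apply/negP.
  case/andP=> /partial_matchingsP[sK s_id _] /eqP sm.
  by have := sK m; rewrite sm s_id // => pm; rewrite pm ltnn in ltmp.
rewrite (exchange_big_dep (mem (partial_matchings m h.+1))) /=; last first.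
  by move=> p t _ /andP[].
rewrite mulr_sumr; apply: eq_bigr => t t_pm.
rewrite -mulr_sumr mulrC; congr (_ * _).
have /partial_matchingsP[_ _ card_fix] := t_pm.
rewrite -(sum_first (c m) card_fix); apply: eq_bigl => p.
by rewrite t_pm inE.
Qed.

(** Both sides satisfy the same recurrence.  The step weights have to agree only
    when [i] and [h] have opposite parities: with [h.+1] arcs waiting before
    position [i], the other case does not occur and the path sum vanishes. *)
Lemma sum_matching_weight (a : nat -> R) m h :
  (forall (i : 'I_N) h, odd i != odd h ->
     c i true + h%:R * c i false = a h.+1) ->
  (m <= N)%N ->
  \sum_(s in partial_matchings m h) matching_weight s = path_sum a 1 m h.
Proof.
move=> c_a; elim: m h => [|m IHm] h lemN; first exact: sum_matching_weight0.
rewrite (sum_matching_weight_rec (Ordinal lemN)) (IHm h.+1 (ltnW lemN)).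
rewrite [RHS]/= add1n.
congr (_ + _); first by case: h => [//|h]; rewrite (IHm h (ltnW lemN)).
have [odd_mh|] := boolP (odd m != odd h); first by rewrite c_a.
move=> eq_mh; rewrite [path_sum _ _ _ _]path_sum_parity ?mulr0 //=.
by case: (odd m) (odd h) eq_mh => [] [].
Qed.

Lemma fpf_involutionsP s :
  reflect (involutive s /\ forall i, s i != i) (s \in fpf_involutions N).
Proof.
rewrite inE; apply: (iffP forallP) => [s_fpf|[sK s_neq] i]; last first.
  by rewrite sK eqxx s_neq.
by split=> i; case/andP: (s_fpf i) => // /eqP.
Qed.

Lemma fpf_partial_matchings : fpf_involutions N = partial_matchings N 0.
Proof.
apply/setP => s; apply/fpf_involutionsP/partial_matchingsP.
  case=> sK s_neq; split=> // [i|]; first by rewrite leqNgt ltn_ord.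
  by apply: eq_card0 => i; rewrite !inE (negPf (s_neq i)) andbF.
case=> sK _ /eqP; rewrite cards_eq0 => /eqP/setP fix0; split=> // i.
by have := fix0 i; rewrite !inE ltn_ord => /negbT.
Qed.

(** A violation of one condition at [j] is a violation of the other at [s j]. *)
Lemma antirecord_closes_first s i :
  s \in fpf_involutions N -> is_antirecord s i = closes_first s i.
Proof.
case/fpf_involutionsP=> sK s_neq.
apply/forallP/forallP => s_i j; apply/implyP.
  move=> ltj; rewrite s_neq ltnNge leq_eqVlt negb_or /=; apply/andP; split.
    by apply: contraTneq ltj => /val_inj ->; rewrite sK ltnn.
  by apply: contraL ltj => /(implyP (s_i _)); rewrite sK -leqNgt => /ltnW.
move=> ltij; rewrite ltnNge leq_eqVlt negb_or; apply/andP; split.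
  by apply: contraTneq ltij => /val_inj/perm_inj ->; rewrite ltnn.
apply: contraL ltij => /(implyP (s_i _)); rewrite sK => /andP[_ ltji].
by rewrite -leqNgt ltnW.
Qed.

Lemma involution_cycle_peak s i : involutive s -> cycle_peak s i = (s i < i)%N.
Proof.
by move=> sK; rewrite /cycle_peak -{1}(sK i) permK andbb.
Qed.

End Involutions.

(** * Counting by cycle peaks *)

Section PeakStatistics.
Variable R : comNzRingType.
Variables x y u v : R.

Definition closer_weight N (i : 'I_N) (first : bool) : R :=
  if odd_index i then (if first then y else v) else (if first then x else u).

Lemma expr_card_set (T : finType) (P : pred T) z :
  z ^+ #|[set i | P i]| = \prod_(i : T) (if P i then z else 1) :> R.
Proof.
by rewrite -big_mkcond -prodr_const; apply: eq_bigl => i; rewrite inE.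
Qed.

Lemma prod_peak_stats N (s : 'S_N) : s \in fpf_involutions N ->
  x ^+ ecpar s * y ^+ ocpar s * u ^+ ecpnar s * v ^+ ocpnar s =
  matching_weight (@closer_weight N) s.
Proof.
move=> s_fpf; have [sK s_neq] := fpf_involutionsP _ s_fpf.
rewrite !expr_card_set -!big_split /matching_weight [RHS]big_mkcond.
apply: eq_bigr => i _; rewrite /= !involution_cycle_peak //.
have [lt_si_i|] /= := boolP (s i < i)%N; last by rewrite !mulr1.
rewrite /closer_weight /even_index -/(odd_index i) antirecord_closes_first //.
by case: (odd_index i) (closes_first s i) => [] []; rewrite /= ?mulr1 ?mul1r.
Qed.

Lemma sum_peak_stats (a : nat -> R) N :
  (forall k, (1 <= k)%N -> a (2 * k - 1)%N = x + (2 * k - 2)%:R * u) ->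
  (forall k, (1 <= k)%N -> a (2 * k)%N = y + (2 * k - 1)%:R * v) ->
  \sum_(s in fpf_involutions N)
     x ^+ ecpar s * y ^+ ocpar s * u ^+ ecpnar s * v ^+ ocpnar s =
  path_sum a 1 N 0.
Proof.
move=> a_odd a_even; rewrite (eq_bigr _ (@prod_peak_stats N)).
rewrite fpf_partial_matchings; apply: sum_matching_weight => // i h neq_odd.
rewrite /closer_weight /odd_index /=; have := odd_double_half h.
move: neq_odd; case: (odd i); case: (odd h) => //= _ <-.
  by have := a_odd h./2.+1 isT; rewrite mul2n doubleS !subSS !subn0.
by have := a_even h./2.+1 isT; rewrite mul2n doubleS subn1.
Qed.

End PeakStatistics.

(** * Exchanging peaks and valleys by reversal *)

Section Reversal.
Variable m : nat.
Implicit Types (s : 'S_m) (i j : 'I_m).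

Definition rev_perm : 'S_m := perm (@rev_ord_inj m).
Definition reverse s : 'S_m := (s ^ rev_perm)%g.

Lemma reverseE s i : reverse s (rev_ord i) = rev_ord (s i).
Proof. by have := permJ s rev_perm i; rewrite !permE. Qed.

Lemma reverseV s : ((reverse s)^-1 = reverse s^-1)%g.
Proof. by rewrite /reverse conjVg. Qed.

Lemma ltn_rev_ord i j : (rev_ord i < rev_ord j)%N = (j < i)%N.
Proof. by rewrite /= ltn_sub2lE ?ltnS. Qed.

Lemma reverse_fpf s :
  (reverse s \in fpf_involutions m) = (s \in fpf_involutions m).
Proof.
rewrite !inE; apply/forallP/forallP => s_fpf i.
  by have := s_fpf (rev_ord i); rewrite !reverseE !(inj_eq rev_ord_inj).
by rewrite -(rev_ordK i) !reverseE !(inj_eq rev_ord_inj).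
Qed.

Lemma reverse_cycle_peak s i :
  cycle_peak (reverse s) (rev_ord i) = cycle_valley s i.
Proof. by rewrite /cycle_peak reverseV !reverseE !ltn_rev_ord. Qed.

Lemma reverse_antirecord s i :
  is_antirecord (reverse s) (rev_ord i) = is_record s i.
Proof.
apply/forallP/forallP => s_i j.
  by have := s_i (rev_ord j); rewrite !reverseE !ltn_rev_ord.
by rewrite -(rev_ordK j) !reverseE !ltn_rev_ord.
Qed.

Lemma card_rev (P Q : pred 'I_m) : (forall i, P (rev_ord i) = Q i) ->
  #|[set i | P i]| = #|[set i | Q i]|.
Proof.
move=> PQ; rewrite -(card_preimset _ rev_ord_inj).
by apply: eq_card => i; rewrite !inE PQ.
Qed.

Hypothesis even_m : ~~ odd m.

Lemma even_index_rev i : even_index (rev_ord i) = odd_index i.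
Proof.
rewrite /even_index /odd_index /= negbK oddB //.
by rewrite (negPf even_m).
Qed.

Lemma odd_index_rev i : odd_index (rev_ord i) = even_index i.
Proof. by rewrite -even_index_rev rev_ordK. Qed.

Definition rev_indexE :=
  (reverse_cycle_peak, reverse_antirecord, even_index_rev, odd_index_rev).

Lemma reverse_stats s :
  [/\ ecpar (reverse s) = ocvr s, ocpar (reverse s) = ecvr s,
      ecpnar (reverse s) = ocvnr s & ocpnar (reverse s) = ecvnr s].
Proof. by split; apply: card_rev => i; rewrite !rev_indexE. Qed.

End Reversal.

(** * The two interpretations of the continued fraction *)

Theorem theorem4p1
  (alpha : nat -> {mpoly int[4]})
  (halpha_odd : forall k : nat, (1 <= k)%N ->
     alpha (2 * k - 1)%N = X + (2 * k - 2)%:R * U)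
  (halpha_even : forall k : nat, (1 <= k)%N ->
     alpha (2 * k)%N = Y + (2 * k - 1)%:R * V)
  (M : nat -> {mpoly int[4]})
  (hM : is_Sfraction alpha M)
  (n : nat) :
  M n = \sum_(s in fpf_involutions (2 * n))
          X ^+ ecpar s * Y ^+ ocpar s * U ^+ ecpnar s * V ^+ ocpnar s
  /\
  M n = \sum_(s in fpf_involutions (2 * n))
          X ^+ ocvr s * Y ^+ ecvr s * U ^+ ocvnr s * V ^+ ecvnr s.
Proof.
have peaks : M n = \sum_(s in fpf_involutions (2 * n))
    X ^+ ecpar s * Y ^+ ocpar s * U ^+ ecpnar s * V ^+ ocpnar s.
  rewrite (sum_peak_stats _ halpha_odd halpha_even) mul2n.
  exact: Sfraction_path_sum hM.
split=> //; rewrite peaks (reindex_inj (conjg_inj (rev_perm _))) /=.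
apply: eq_big => [s|s _]; first exact: reverse_fpf.
have even_2n : ~~ odd (2 * n) by rewrite mul2n odd_double.
by have [-> -> -> ->] := reverse_stats even_2n s.
Qed.
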